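(* Let $r\ge 1$ and $0\le s<r+1$ be fixed real numbers, and put $$m=\frac{1}{\left(\frac32\right)^{1/r}-1}-2,\qquad \rho=\frac23\,\min\{1,\;r-s+1\}.$$ Let $a_i>0$ ($i\ge 1$) and $b_i\in\mathbb{R}$ ($i\ge 0$) satisfy, as $i\to\infty$, $$a_i=i^r+o\left(i^{r-\rho}\right),\qquad b_i=\gamma\, i^s+o\left(i^{r-\rho}\right),$$ where the constant $\gamma\ge 0$ satisfies $$\gamma\le\frac{(m+2)^{r-s+1}}{2s}\ \text{ if } 0<s<1,\qquad \gamma\le\frac{(m+3)^{r-s+1}}{3s}\ \text{ if } 1\le s<r+1$$ (no upper bound on $\gamma$ is imposed if $s=0$). Let $\delta>0$ be any fixed number with $$\delta<2r\ \text{ if } 0\le s<r,\qquad \delta<(2+\gamma)r\ \text{ if } s=r,\qquad \delta<\gamma s\ \text{ if } r<s<r+1.$$ Then for all sufficiently large $k$ the largest zero of $p_k$ does not exceed $$\gamma k^s+k^r\left(2-2^{-4/3}\delta^{2/3}k^{-\rho}\right)+o\left(k^{r-\rho}\right).$$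
   Context: The polynomials $p_k$ are the orthogonal polynomials defined by $p_{-1}=0$, $p_0=1$ and $$\frac{a_k}{c_k}\,p_k=(x-b_{k-1})p_{k-1}-a_{k-1}c_{k-1}\,p_{k-2},\qquad k\ge1,$$ with the convention $a_0=0$, where the $c_k>0$ fix the normalization ($c_k\equiv1$ is the orthonormal one, $c_k=a_k$ the monic one); the zeros of $p_k$ do not depend on the choice of the $c_k$. The conclusion means that there is a function $\varepsilon(k)=o(k^{r-\rho})$, $k\to\infty$, such that for all sufficiently large $k$ the largest zero of $p_k$ is at most $\gamma k^s+k^r(2-2^{-4/3}\delta^{2/3}k^{-\rho})+\varepsilon(k)$. *)

(* Defs.v *)
From HB Require Import structures.
From mathcomp Require Import all_boot all_order all_algebra.
From mathcomp Require Import all_classical all_reals all_analysis.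
Set Implicit Arguments.
Unset Strict Implicit.
Unset Printing Implicit Defensive.
Import Order.TTheory GRing.Theory Num.Theory.
Import numFieldNormedType.Exports.
Local Open Scope classical_set_scope.
Local Open Scope ring_scope.

(* The recurrence determining p_k from p_{k-1} and p_{k-2} is written at index
   k.+1; the [if] encodes p_{-1} = 0.  When the [a i] and [c i], i >= 1, are
   nonzero there is exactly one such sequence [p]. *)
Definition orthogonal_polynomials (R : realType) (a b c : nat -> R)
    (p : nat -> {poly R}) : Prop :=
  p 0%N = 1 /\
  forall k : nat,
    (a k.+1 / c k.+1) *: p k.+1 =
      ('X - (b k)%:P) * p k - (a k * c k) *: (if k is j.+1 then p j else 0).

Definition is_largest_zero (R : realType) (q : {poly R}) (x : R) : Prop :=
  root q x /\ forall y : R, root q y -> y <= x.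

(* Main.v *)
Require Import Defs.
From HB Require Import structures.
From mathcomp Require Import all_boot all_order all_algebra.
From mathcomp Require Import all_classical all_reals all_analysis.
From mathcomp Require Import ring lra.
Set Implicit Arguments.
Unset Strict Implicit.
Unset Printing Implicit Defensive.
Import Order.TTheory GRing.Theory Num.Theory.
Import numFieldNormedType.Exports.
Local Open Scope classical_set_scope.
Local Open Scope ring_scope.

(** The zeros of [p k] are the eigenvalues of a Jacobi matrix with diagonal
    [b 0 .. b k.-1] and off-diagonal [a 1 .. a k.-1]; the largest one is
    controlled by a positive supersolution, here in ratio (Riccati) form: if
    [h i > 0] and [h i.+1 + a i ^+ 2 / h i <= x - b i] for [i < k], then every
    normalized ratio of consecutive polynomials dominates [h] at each [y >= x],
    so that [p k] is positive there ([positive_of_supersolution]).  Since a zero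
    of [p k] exists ([largest_zero_interlacing]), the largest one is below [x].

    With K = k^r, the choice is [h i = K (1 - v i)], where [v] vanishes in the
    bulk and grows linearly over the last few indices,
      v i = max (0, z - 3 z^2 (k - i)),  z^2 = 2^(-4/3) delta^(2/3) k^(-rho).
    In the continuum limit the inequality to satisfy is w' + w^2 <= d t - e on
    the half line, with t the rescaled distance k - i and d t the amount by
    which a i ^+ 2 and b i fall below their values at the edge.
    - Where [v] is positive its slope 3 z^2 pays for v^2 <= z^2 and for the
      target z^2, without any help from a and b.
    - Where [v] vanishes, 3 z (k - i) >= 1, and at such a distance the decrease
      of i^(2 r) and of gamma i^s suffices ([total_gain]).  This is where delta
      enters: its upper bounds say that 4 z^3 k <= 2 r + gamma s k^(s - r)
      ([edge_scale_balance]).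
    Both parts leave a margin proportional to z^2.  Since r - rho > 0, the
    hypotheses on a and b give errors that are eventually at most K z^2 / 100
    uniformly in i <= k ([littleo_uniform]), and the margin absorbs them.  The
    bound therefore holds eventually with [eps = 0].

    The optimal constant in this Riccati problem is governed by the first zero
    of the Airy function; the one required here is several times smaller, which
    is why a piecewise linear [v] is enough. *)

(** * Zeros of a polynomial *)

Lemma sign_change_root (R : realType) (q : {poly R}) (u w : R) :
  u <= w -> q.[u] <= 0 -> 0 <= q.[w] -> exists2 y : R, u <= y & root q y.
Proof.
move=> uw qu qw; have [|y /andP[uy _] qy] := @poly_ivt R q u w uw.
  by apply/andP.
by exists y.
Qed.

(** Dividing out a known zero lowers the degree, and the largest zero of the
    quotient, if it has any, competes only with the zero divided out. *)
Lemma exists_largest_zero (R : realType) (n : nat) (q : {poly R}) (z : R) :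
  (size q <= n)%N -> q != 0 -> root q z -> exists x : R, is_largest_zero q x.
Proof.
elim: n q z => [|n IHn] q z sq q0 qz.
  by move: sq; rewrite leqNgt lt0n size_poly_eq0 q0.
have /factor_theorem[q' qE] := qz.
have q'0 : q' != 0 by apply: contraNneq q0 => q'0; rewrite qE q'0 mul0r.
have rE y : root q y = root q' y || (y == z).
  by rewrite qE rootM root_XsubC.
have [[y q'y]|noroot] := pselect (exists y, root q' y); last first.
  exists z; split => // y; rewrite rE => /orP[q'y|/eqP->//].
  by case: noroot; exists y.
have [|x [q'x xmax]] := IHn q' y _ q'0 q'y.
  by move: sq; rewrite qE size_Mmonic ?monicXsubC// size_XsubC addn2.
exists (Num.max x z); split.
  by rewrite rE; case: leP => _; rewrite ?q'x ?eqxx ?orbT.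
move=> w; rewrite rE le_max => /orP[/xmax->//|/eqP->].
by rewrite lexx orbT.
Qed.

(** * Supersolutions of the recurrence, and interlacing *)

Lemma recurrence_value (R : realType) (a b c : nat -> R) (p : nat -> {poly R})
    (k : nat) (y : R) : orthogonal_polynomials a b c p ->
  a k.+1 / c k.+1 * (p k.+1).[y] =
    (y - b k) * (p k).[y]
    - a k * c k * (if k is j.+1 then (p j).[y] else 0).
Proof.
move=> [_ /(_ k) /(congr1 (horner^~ y))].
by case: k => [|k]; rewrite !hornerE.
Qed.

(** By induction on [j], [a j.+1 / c j.+1 * p j.+1 / p j >= h j.+1] at [y]: the
    recurrence makes this ratio equal to [y - b j] minus [a j ^+ 2] divided by
    the preceding ratio; the subtracted term vanishes at [j = 0], where
    [a 0 = 0]. *)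
Lemma positive_of_supersolution (R : realType) (a b c : nat -> R)
    (p : nat -> {poly R}) (h : nat -> R) (n : nat) (x : R) :
  (forall i, (1 <= i)%N -> 0 < a i) -> a 0%N = 0 ->
  (forall i, (1 <= i)%N -> 0 < c i) ->
  orthogonal_polynomials a b c p ->
  (forall j, (j <= n)%N -> 0 < h j) ->
  (forall j, (j < n)%N -> h j.+1 + a j ^+ 2 / h j <= x - b j) ->
  forall y, x <= y -> forall j, (j <= n)%N -> 0 < (p j).[y].
Proof.
move=> a_gt0 a0 c_gt0 hp h_gt0 hh y xy j jn.
(* The second conjunct is the ratio bound multiplied by a j * c j / h j; in this
   form it also makes sense at j = 0. *)
suff [] : 0 < (p j).[y] /\
    a j * c j * (if j is i.+1 then (p i).[y] else 0) <= a j ^+ 2 / h j * (p j).[y].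
  by [].
elim: j jn => [|j IHj] jn.
  by split; [case: hp => -> _; rewrite hornerC | rewrite a0 !mul0r expr0n/= !mul0r].
have [pj_gt0 prev] := IHj (ltnW jn).
have A := a_gt0 j.+1 isT; have C := c_gt0 j.+1 isT.
have H := h_gt0 _ jn.
have ratio : h j.+1 * (p j).[y] <= a j.+1 / c j.+1 * (p j.+1).[y].
  rewrite (recurrence_value j y hp) lerBrDr.
  apply: le_trans (lerD (lexx _) prev) _.
  rewrite -mulrDl ler_pM2r//; apply: le_trans (hh j jn) _.
  by rewrite lerB.
split.
  rewrite -(pmulr_rgt0 _ (divr_gt0 A C)); apply: lt_le_trans ratio.
  exact: mulr_gt0.
have -> : a j.+1 * c j.+1 * (p j).[y] =
    a j.+1 * c j.+1 / h j.+1 * (h j.+1 * (p j).[y]).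
  by field; rewrite gt_eqF.
have -> : a j.+1 ^+ 2 / h j.+1 * (p j.+1).[y] =
    a j.+1 * c j.+1 / h j.+1 * (a j.+1 / c j.+1 * (p j.+1).[y]).
  by field; rewrite !gt_eqF.
by rewrite ler_wpM2l// divr_ge0 ?mulr_ge0// ltW.
Qed.

(** The constant [h = 1] is a supersolution as soon as [x] is large. *)
Lemma eventually_positive (R : realType) (a b c : nat -> R)
    (p : nat -> {poly R}) (n : nat) :
  (forall i, (1 <= i)%N -> 0 < a i) -> a 0%N = 0 ->
  (forall i, (1 <= i)%N -> 0 < c i) ->
  orthogonal_polynomials a b c p ->
  exists x : R, forall y, x <= y -> 0 < (p n).[y].
Proof.
move=> a_gt0 a0 c_gt0 hp.
exists (1 + \sum_(i < n) (a i ^+ 2 + `|b i|)) => y xy.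
apply: (positive_of_supersolution (h := fun=> 1) (n := n) a_gt0 a0 c_gt0 hp _ _ xy) => //.
move=> j jn; rewrite (bigD1 (Ordinal jn))//= invr1 mulr1.
have := ler_norm (b j).
have : 0 <= \sum_(i < n | i != Ordinal jn) (a i ^+ 2 + `|b i|).
  by apply: sumr_ge0 => i _; rewrite addr_ge0 ?sqr_ge0.
lra.
Qed.

(** At the largest zero [z] of [p k.+1], where [p k] is positive, the recurrence
    makes [p k.+2] negative; as [p k.+2] is positive far to the right, it has a
    zero beyond [z].  The positivity of [p k] to the right of that zero is what
    makes the induction go through. *)
Lemma largest_zero_interlacing (R : realType) (a b c : nat -> R)
    (p : nat -> {poly R}) (k : nat) :
  (forall i, (1 <= i)%N -> 0 < a i) -> a 0%N = 0 ->
  (forall i, (1 <= i)%N -> 0 < c i) ->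
  orthogonal_polynomials a b c p ->
  exists2 z : R, is_largest_zero (p k.+1) z &
    forall y, z <= y -> 0 < (p k).[y].
Proof.
move=> a_gt0 a0 c_gt0 hp.
(* The induction step; it also starts the induction, from [p 0 = 1]. *)
have next j u : (p j.+1).[u] < 0 -> (forall y, u < y -> 0 < (p j).[y]) ->
    exists2 z : R, is_largest_zero (p j.+1) z & forall y, z <= y -> 0 < (p j).[y].
  move=> pu pj.
  have [X posX] := eventually_positive j.+1 a_gt0 a0 c_gt0 hp.
  have [||z uz pz] := @sign_change_root R (p j.+1) u (Num.max u X) _ (ltW pu).
  - by rewrite le_max lexx.
  - by rewrite ltW// posX// le_max lexx orbT.
  have p0 : p j.+1 != 0.
    by apply/eqP => p0; have := posX X (lexx X); rewrite p0 horner0 ltxx.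
  have {}uz : u < z.
    by rewrite lt_neqAle uz andbT; apply: contraTneq pu => ->; rewrite (rootP pz) ltxx.
  have [w [pw wmax]] := exists_largest_zero (leqnn _) p0 pz.
  exists w => // y wy; apply: pj.
  by rewrite (lt_le_trans uz)// (le_trans (wmax _ pz)).
elim: k => [|k [z [pz zmax] posz]].
  have p00 y : (p 0%N).[y] = 1 by case: hp => -> _; rewrite hornerC.
  (* Any point to the left of the zero b 0 of p 1 would do. *)
  apply: (next 0%N (b 0%N - 1)) => [|y _]; last by rewrite p00.
  have := recurrence_value 0%N (b 0%N - 1) hp.
  rewrite p00 mulr0 subr0 mulr1 addrAC subrr add0r => pE.
  by rewrite -(pmulr_rlt0 _ (divr_gt0 (a_gt0 1%N isT) (c_gt0 1%N isT))) pE ltrN10.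
apply: (next k.+1 z) => [|y zy].
  rewrite -(pmulr_rlt0 _ (divr_gt0 (a_gt0 k.+2 isT) (c_gt0 k.+2 isT))).
  rewrite (recurrence_value _ _ hp) (rootP pz) mulr0 sub0r oppr_lt0.
  by rewrite !mulr_gt0 ?a_gt0 ?c_gt0 ?posz.
have [X posX] := eventually_positive k.+1 a_gt0 a0 c_gt0 hp.
rewrite ltNge; apply/negP => py.
have [||w yw /zmax wz] := @sign_change_root R (p k.+1) y (Num.max y X) _ py.
- by rewrite le_max lexx.
- by rewrite ltW// posX// le_max lexx orbT.
by have := lt_le_trans zy (le_trans yw wz); rewrite ltxx.
Qed.

(** * The local inequality *)

(** The supersolution inequality at one index, divided by K: [v] and [v'] are
    consecutive values of the profile, [th] is [a i / K], [q] its unperturbed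
    value and [g] the normalized drop of the diagonal between index [i] and the
    edge.  The first alternative is the edge region, where [v' - v] outweighs
    the excess of [1 / (1 - v)] over [1 + v]; the second is the bulk. *)
Lemma riccati_step (R : realType) (z v v' th q g : R) :
  0 < z -> z <= 1 / 4 -> 0 <= v -> v <= z ->
  0 <= th -> th <= q + z ^+ 2 / 100 -> 0 <= q -> q <= 1 -> 0 <= g ->
  v + 3 * z ^+ 2 <= v' \/
    [/\ v = 0, 0 <= v' & 16 / 13 * z ^+ 2 <= 1 - q ^+ 2 + g] ->
  (1 - v') + th ^+ 2 / (1 - v) <= 2 + g - 101 / 100 * z ^+ 2.
Proof.
move=> z0 z4 v0 vz th0 thq q0 q1 g0 cases.
have z2 : z ^+ 2 <= 1 / 16 by rewrite expr2; nra.
have z20 : 0 <= z ^+ 2 by exact: sqr_ge0.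
set e := z ^+ 2 in thq cases z2 z20 *.
have th2 : th ^+ 2 <= q ^+ 2 + 3 / 100 * e.
  have : th ^+ 2 <= (q + e / 100) ^+ 2 by rewrite lerXn2r// nnegrE; lra.
  have : q * e <= e by rewrite -[leRHS]mul1r ler_wpM2r.
  have : e * e <= e by rewrite -[leRHS]mul1r ler_wpM2r//; lra.
  rewrite !expr2; nra.
case: cases => [vv'|[-> v'0 qg]]; last by rewrite subr0 divr1; lra.
have q2 : q ^+ 2 <= 1 by rewrite expr_le1.
have ve : v ^+ 2 <= e by rewrite lerXn2r// nnegrE; lra.
suff : th ^+ 2 / (1 - v) <= 1 + v + 3 / 2 * e by lra.
rewrite ler_pdivrMr; last lra.
have : v * e <= e / 4 by have : v * e <= 1 / 4 * e by [rewrite ler_wpM2r//; lra]; lra.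
rewrite !expr2 in ve th2 q2 *; nra.
Qed.

(** * Decay away from the edge *)

(** With u = 1 - x, the chain is x^q <= exp (- q u) <= 1 / (1 + q u).  This form
    is linear in u near the edge and yet valid far from it, so that the bulk
    needs no separate argument. *)
Lemma powR_le_inv_affine (R : realType) (x q : R) : 0 <= x -> x <= 1 -> 0 <= q ->
  x `^ q <= (1 + q * (1 - x))^-1.
Proof.
move=> x0 x1 q0.
have D : 0 < 1 + q * (1 - x) by rewrite ltr_wpDr// mulr_ge0// subr_ge0.
have [->|xn0] := eqVneq x 0.
  have [->|qn0] := eqVneq q 0; first by rewrite powRr0 mul0r addr0 invr1.
  by rewrite powR0// invr_ge0 subr0 mulr1 addr_ge0.
rewrite /powR (negbTE xn0) -lef_pV2 ?posrE ?invr_gt0 ?expR_gt0// invrK -expRN.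
apply: le_trans (expR_ge1Dx _); rewrite lerD2l -mulrN ler_wpM2l//.
have := @le_ln1Dx R (x - 1); rewrite addrCA subrr addr0 => lnx.
by rewrite lerNr opprB lnx// ltrBrDl subrr lt_neqAle eq_sym xn0.
Qed.

(** The bound u / (1 + u) on [1 - x `^ q] is increasing in u = q (1 - x), so it
    may be read off at the smallest admissible distance [T]; 12 / 13 is the
    value of 1 / (1 + u) at u = 1 / 12. *)
Lemma powR_gain (R : realType) (x q T : R) : 0 <= x -> 0 <= q -> 0 <= T ->
  T <= 1 - x -> q * T <= 1 / 12 -> 12 / 13 * (q * T) <= 1 - x `^ q.
Proof.
move=> x0 q0 T0 Tx qT.
have x1 : x <= 1 by lra.
have := powR_le_inv_affine x0 x1 q0; set u := q * (1 - x) => xq.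
have uT : q * T <= u by rewrite ler_wpM2l.
have qT0 : 0 <= q * T by rewrite mulr_ge0.
suff : (1 + u)^-1 <= 1 - 12 / 13 * (q * T) by lra.
rewrite -[leLHS]mul1r ler_pdivrMr; last lra.
nra.
Qed.

(** * Asymptotics *)

Lemma powR_unbounded (R : realType) (q C : R) : 0 < q ->
  \forall k \near \oo, C <= (k%:R : R) `^ q.
Proof.
move=> q0; near=> k.
have Ck : `|C| `^ q^-1 <= k%:R by near: k; exact: nbhs_infty_ger.
apply: le_trans (ler_norm C) _.
have -> : `|C| = (`|C| `^ q^-1) `^ q.
  by rewrite -powRrM mulVf ?gt_eqF// powRr1.
by rewrite ge0_ler_powR ?nnegrE ?powR_ge0// ltW.
Unshelve. all: by end_near. Qed.

(** The finitely many indices where the asymptotic estimate fails contribute a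
    constant, which is negligible because the exponent is positive. *)
Lemma littleo_uniform (R : realType) (f : nat -> R) (q : R) : 0 < q ->
  f =o_\oo (fun i : nat => i%:R `^ q) ->
  forall eps : R, 0 < eps ->
  \forall k \near \oo, forall i, (i <= k)%N -> `|f i| <= eps * k%:R `^ q.
Proof.
move=> q0 /eqoP fo eps eps0.
have [N _ fN] := fo eps eps0.
near=> k => i ik.
have [iN|Ni] := ltnP i N.
  have : (\sum_(j < N) `|f j|) / eps <= k%:R `^ q.
    by near: k; exact: powR_unbounded.
  rewrite ler_pdivrMr// mulrC; apply: le_trans.
  rewrite (bigD1 (Ordinal iN))//= lerDl.
  exact: sumr_ge0.
apply: le_trans (fN i Ni) _; rewrite ler_pM2l// ger0_norm ?powR_ge0//.
by rewrite ge0_ler_powR ?nnegrE ?ler_nat// ltW.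
Unshelve. all: by end_near. Qed.

(** The left side is [delta] times a power of [kk] with exponent
    1 - min (1, r - s + 1), the larger of 0 and s - r: the bounds on [delta]
    compare the coefficients of the dominant terms. *)
Lemma edge_scale_balance (R : realType) (r s rho gamma delta kk : R) :
  1 <= r -> 0 <= s -> s < r + 1 ->
  rho = 2 / 3 * Num.min 1 (r - s + 1) -> 0 <= gamma ->
  (s < r -> delta < 2 * r) -> (s = r -> delta < (2 + gamma) * r) ->
  (r < s -> delta < gamma * s) -> 1 <= kk ->
  delta * (kk `^ (- (rho / 2))) ^+ 3 * kk <= 2 * r + gamma * s * kk `^ (s - r).
Proof.
move=> hr hs0 hs1 hrho g0 d1 d2 d3 k1.
have kk0 : kk != 0 by rewrite gt_eqF//; lra.
rewrite -mulrA; have -> : (kk `^ (- (rho / 2))) ^+ 3 * kk = kk `^ (1 - 3 / 2 * rho).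
  rewrite -powR_mulrn ?powR_ge0// -powRrM -[X in _ * X]powRr1; last lra.
  by rewrite -powRD ?kk0 ?implybT//; congr powR; lra.
have P := powR_gt0 (s - r) (lt_le_trans ltr01 k1).
have N : 0 <= gamma * s * kk `^ (s - r) by rewrite !mulr_ge0// ltW.
have [sr|rs|sr] := ltgtP s r.
- have -> : rho = 2 / 3 by rewrite hrho min_l//; lra.
  have -> : 1 - 3 / 2 * (2 / 3) = 0 :> R by lra.
  rewrite powRr0; have := d1 sr; lra.
- have -> : 1 - 3 / 2 * rho = s - r by rewrite hrho min_r//; lra.
  have := d3 rs => dl.
  have : delta * kk `^ (s - r) <= gamma * s * kk `^ (s - r) by rewrite ler_pM2r// ltW.
  lra.
- have -> : rho = 2 / 3 by rewrite hrho min_l//; lra.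
  have -> : 1 - 3 / 2 * (2 / 3) = 0 :> R by lra.
  rewrite sr subrr powRr0; have := d2 sr; lra.
Qed.

(** Each of [(t / kk) `^ (2 r)] and [(t / kk) `^ s] loses a linear amount at distance
    1 / (3 z) from the edge; the hypothesis on [4 * z ^+ 3 * kk] turns the sum
    of the two losses into 12 / 13 * 4 / 3 = 16 / 13 times z^2. *)
Lemma total_gain (R : realType) (r s gamma z kk t : R) :
  1 <= r -> 0 <= s -> 0 <= gamma -> 1 <= kk -> 0 < z ->
  4 * z ^+ 3 * kk <= 2 * r + gamma * s * kk `^ (s - r) ->
  4 * (2 * r + s) <= z * kk ->
  0 <= t -> 1 <= 3 * z * (kk - t) ->
  16 / 13 * z ^+ 2 <=
    1 - ((t / kk) `^ r) ^+ 2 + gamma * (kk `^ s - t `^ s) / kk `^ r.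
Proof.
move=> hr hs g0 k1 z0 bal big t0 far.
have k0 : 0 < kk by lra.
have zk : 0 < z * kk by rewrite mulr_gt0.
set x := t / kk.
have x0 : 0 <= x by rewrite divr_ge0// ltW.
have tE : t = kk * x by rewrite /x mulrC divfK// gt_eqF.
(* The relative distance to the edge at which the profile vanishes. *)
pose T := (3 * (z * kk))^-1.
have T0 : 0 <= T by rewrite invr_ge0; lra.
have Tx : T <= 1 - x.
  rewrite /T -[leLHS]mul1r ler_pdivrMr; last lra.
  by move: far; rewrite tE; lra.
have qT q : 0 <= q -> q <= 2 * r + s -> q * T <= 1 / 12.
  move=> q0 qb; rewrite /T ler_pdivrMr; lra.
have gr : 12 / 13 * (2 * r * T) <= 1 - (x `^ r) ^+ 2.
  rewrite -powR_mulrn ?powR_ge0// -powRrM [r * _]mulrC.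
  by apply: powR_gain => //; [lra|apply: qT; lra].
have gs : 12 / 13 * (s * T) <= 1 - x `^ s.
  by apply: powR_gain => //; apply: qT; lra.
have -> : gamma * (kk `^ s - t `^ s) / kk `^ r = gamma * kk `^ (s - r) * (1 - x `^ s).
  rewrite tE powRM ?(ltW k0)// powRB ?(gt_eqF k0) ?implybT//.
  by field; rewrite gt_eqF// powR_gt0.
have P : 0 <= gamma * kk `^ (s - r) by rewrite mulr_ge0// powR_ge0.
have gs' := ler_wpM2l P gs.
have balT := ler_wpM2r T0 bal.
have TE : 4 * z ^+ 3 * kk * T = 4 / 3 * z ^+ 2.
  by rewrite /T; field; rewrite !gt_eqF.
rewrite TE in balT; lra.
Qed.

(** The scale [z] is the square root of the correction term of the theorem; its
    constant is the cube root of delta / 4, which makes 4 z^3 proportional to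
    [delta] itself. *)
Lemma edge_scale (R : realType) (rho delta kk : R) : 0 < delta -> 0 < kk ->
  let z := 2 `^ (- (2 / 3)) * delta `^ (1 / 3) * kk `^ (- (rho / 2)) in
  [/\ 0 < z, z ^+ 2 = 2 `^ (- (4 / 3)) * delta `^ (2 / 3) * kk `^ (- rho) &
      4 * z ^+ 3 = delta * (kk `^ (- (rho / 2))) ^+ 3].
Proof.
move=> d0 k0 z.
have cE : (2 `^ (- (2 / 3)) * delta `^ (1 / 3)) ^+ 3 = delta / 4 :> R.
  rewrite exprMn -!powR_mulrn ?powR_ge0// -!powRrM.
  have -> : 1 / 3 * 3 = 1 :> R by lra.
  have -> : - (2 / 3) * 3 = - 2%:R :> R by lra.
  rewrite powRr1 ?ltW// powR_invn//; lra.
split.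
- by rewrite !mulr_gt0 ?powR_gt0.
- rewrite /z !exprMn -!powR_mulrn ?powR_ge0// -!powRrM.
  congr (_ `^ _ * _ `^ _ * _ `^ _); lra.
- rewrite /z exprMn cE; lra.
Qed.

(** The supersolution K (1 - v) for fixed [k]: [v] is zero except within distance
    1 / (3 z) of the edge, where it rises with slope 3 z^2 up to the value [z]
    at [i = k]. *)
Lemma positive_beyond_edge (R : realType) (r s gamma : R) (a b c : nat -> R)
    (p : nat -> {poly R}) (k : nat) (z : R) :
  (forall i, (1 <= i)%N -> 0 < a i) -> a 0%N = 0 ->
  (forall i, (1 <= i)%N -> 0 < c i) ->
  orthogonal_polynomials a b c p ->
  1 <= r -> 0 <= s -> 0 <= gamma -> (1 <= k)%N -> 0 < z -> z <= 1 / 4 ->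
  4 * z ^+ 3 * k%:R <= 2 * r + gamma * s * k%:R `^ (s - r) ->
  4 * (2 * r + s) <= z * k%:R ->
  (forall i, (i <= k)%N -> `|a i - i%:R `^ r| <= z ^+ 2 / 100 * k%:R `^ r) ->
  (forall i, (i <= k)%N ->
    `|b i - gamma * i%:R `^ s| <= z ^+ 2 / 100 * k%:R `^ r) ->
  forall y, gamma * k%:R `^ s + k%:R `^ r * (2 - z ^+ 2) <= y -> 0 < (p k).[y].
Proof.
move=> a_gt0 a0 c_gt0 hp hr hs g0 k1 z0 z4 bal big ea eb y xy.
have kk1 : 1 <= k%:R :> R by rewrite ler1n.
have kk0 : 0 < k%:R :> R by rewrite ltr0n.
set K := k%:R `^ r in ea eb xy.
have K0 : 0 < K by rewrite powR_gt0.
pose v (i : nat) : R := Num.max 0 (z - 3 * z ^+ 2 * (k%:R - i%:R)).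
have v0 i : 0 <= v i by rewrite le_max lexx.
have vz i : (i <= k)%N -> v i <= z.
  move=> ik; rewrite ge_max (ltW z0) gerBl mulr_ge0 ?subr_ge0 ?ler_nat//.
  by rewrite mulr_ge0 ?sqr_ge0.
apply: (positive_of_supersolution (h := fun i => K * (1 - v i)) (n := k)
         a_gt0 a0 c_gt0 hp _ _ xy) => // i ik.
  by rewrite mulr_gt0//; have := vz i ik; lra.
have ik' := ltnW ik.
have iK : i%:R <= k%:R :> R by rewrite ler_nat.
have vi1 : 0 < 1 - v i by have := vz i ik'; lra.
have ai0 : 0 <= a i by case: (i) => [|j]; [rewrite a0|apply/ltW/a_gt0].
pose g := gamma * (k%:R `^ s - i%:R `^ s) / K.
have g_ge0 : 0 <= g.
  rewrite divr_ge0 ?(ltW K0)// mulr_ge0// subr_ge0.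
  by rewrite ge0_ler_powR ?nnegrE.
have xk1 : i%:R / k%:R <= 1 :> R by rewrite ler_pdivrMr// mul1r.
have xk0 : 0 <= i%:R / k%:R :> R by rewrite divr_ge0.
have qK : (i%:R / k%:R) `^ r * K = i%:R `^ r.
  by rewrite -powRM// divfK// gt_eqF.
have q1 : (i%:R / k%:R) `^ r <= 1.
  suff : (i%:R / k%:R) `^ r <= 1 `^ r by rewrite powR1.
  by rewrite ge0_ler_powR ?nnegrE//; lra.
have thq : a i / K <= (i%:R / k%:R) `^ r + z ^+ 2 / 100.
  rewrite ler_pdivrMr// mulrDl qK -lerBlDl; apply: le_trans (ea i ik').
  exact: ler_norm.
have step : v i + 3 * z ^+ 2 <= v i.+1 \/
    [/\ v i = 0, 0 <= v i.+1 &
      16 / 13 * z ^+ 2 <= 1 - ((i%:R / k%:R) `^ r) ^+ 2 + g].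
  have [far|near] := leP (z - 3 * z ^+ 2 * (k%:R - i%:R)) 0.
    right; split=> //; first by rewrite /v max_l.
    apply: total_gain => //.
    by rewrite -(ler_pM2l z0); move: far; rewrite expr2; lra.
  left; rewrite /v (max_r (ltW near)) le_max; apply/orP; right.
  by rewrite -natr1; lra.
have := riccati_step z0 z4 (v0 i) (vz i ik') (divr_ge0 ai0 (ltW K0)) thq
  (powR_ge0 _ _) q1 g_ge0 step.
rewrite -(ler_pM2l K0).
have -> : K * (1 - v i.+1 + (a i / K) ^+ 2 / (1 - v i)) =
    K * (1 - v i.+1) + a i ^+ 2 / (K * (1 - v i)).
  by field; rewrite !gt_eqF.
move=> /le_trans; apply.
have gK : K * g = gamma * (k%:R `^ s - i%:R `^ s).
  by rewrite /g mulrC divfK// gt_eqF.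
have := le_trans (ler_norm _) (eb i ik').
by rewrite mulrBr mulrDr gK; lra.
Qed.

(** * The bound on the largest zero *)

Theorem theorem2 (R : realType) (r s m rho gamma delta : R)
    (a b c : nat -> R) (p : nat -> {poly R})
    (hr : 1 <= r) (hs0 : 0 <= s) (hs1 : s < r + 1)
    (hm : m = 1 / ((3 / 2) `^ (1 / r) - 1) - 2)
    (hrho : rho = 2 / 3 * Num.min 1 (r - s + 1))
    (ha_pos : forall i : nat, (1 <= i)%N -> 0 < a i)
    (ha0 : a 0%N = 0)
    (hc_pos : forall k : nat, (1 <= k)%N -> 0 < c k)
    (hp : orthogonal_polynomials a b c p)
    (ha : (fun i : nat => a i - i%:R `^ r)
            =o_\oo (fun i : nat => i%:R `^ (r - rho)))
    (hb : (fun i : nat => b i - gamma * i%:R `^ s)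
            =o_\oo (fun i : nat => i%:R `^ (r - rho)))
    (hgamma0 : 0 <= gamma)
    (hgamma1 : 0 < s -> s < 1 ->
      gamma <= (m + 2) `^ (r - s + 1) / (2 * s))
    (hgamma2 : 1 <= s -> s < r + 1 ->
      gamma <= (m + 3) `^ (r - s + 1) / (3 * s))
    (hdelta0 : 0 < delta)
    (hdelta1 : 0 <= s -> s < r -> delta < 2 * r)
    (hdelta2 : s = r -> delta < (2 + gamma) * r)
    (hdelta3 : r < s -> s < r + 1 -> delta < gamma * s) :
  exists2 eps : nat -> R,
    eps =o_\oo (fun k : nat => k%:R `^ (r - rho)) &
    \forall k \near \oo,
      exists2 x : R, is_largest_zero (p k) x &
        x <= gamma * k%:R `^ s
             + k%:R `^ r * (2 - 2 `^ (- (4 / 3)) * delta `^ (2 / 3)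
                                * k%:R `^ (- rho))
             + eps k.
Proof.
have hdelta1' := hdelta1 hs0.
have hdelta3' sr := hdelta3 sr hs1.
have [rho_gt0 rho_le] : 0 < rho /\ rho <= 2 / 3.
  have : 0 < Num.min 1 (r - s + 1) by rewrite lt_min ltr01/=; lra.
  have : Num.min 1 (r - s + 1) <= 1 by rewrite ge_min lexx.
  by rewrite hrho; lra.
pose c0 : R := 2 `^ (- (2 / 3)) * delta `^ (1 / 3).
have c0_gt0 : 0 < c0 by rewrite mulr_gt0// powR_gt0.
exists (fun=> 0).
  by apply/eqoP => e e0; near=> k; rewrite normr0 mulr_ge0// ltW.
have e_gt0 : 0 < c0 ^+ 2 / 100 by rewrite divr_gt0// exprn_gt0.
have q_gt0 : 0 < r - rho by lra.
near=> k.
have k1 : (1 <= k)%N by near: k; exact: nbhs_infty_ge.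
have kk0 : 0 < k%:R :> R by rewrite ltr0n.
have [z_gt0 z2 z3] := edge_scale rho hdelta0 kk0.
set z := _ * _ * _ in z_gt0 z2 z3.
have errE : c0 ^+ 2 / 100 * k%:R `^ (r - rho) = z ^+ 2 / 100 * k%:R `^ r.
  rewrite /z -/c0 [(c0 * _) ^+ 2]exprMn -[(_ `^ (- (rho / 2))) ^+ 2]powR_mulrn ?powR_ge0//.
  rewrite -powRrM powRD ?(gt_eqF kk0) ?implybT//.
  have -> : - (rho / 2) * 2 = - rho by lra.
  lra.
have z_le : z <= 1 / 4.
  rewrite /z -/c0 powRN ler_pdivrMr ?powR_gt0//.
  suff : 4 * c0 <= k%:R `^ (rho / 2) by lra.
  by near: k; apply: powR_unbounded; lra.
have zk : 4 * (2 * r + s) <= z * k%:R.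
  rewrite /z -/c0 -mulrA -[X in _ * (_ * X)](@powRr1 _ k%:R)//.
  rewrite -powRD ?(gt_eqF kk0) ?implybT// [c0 * _]mulrC -ler_pdivrMr//.
  by near: k; apply: powR_unbounded; lra.
have bal : 4 * z ^+ 3 * k%:R <= 2 * r + gamma * s * k%:R `^ (s - r).
  by rewrite z3; apply: (edge_scale_balance hr hs0 hs1 hrho); rewrite ?ler1n.
have ea : forall i, (i <= k)%N -> `|a i - i%:R `^ r| <= z ^+ 2 / 100 * k%:R `^ r.
  rewrite -errE; near: k; exact: littleo_uniform.
have eb : forall i, (i <= k)%N ->
    `|b i - gamma * i%:R `^ s| <= z ^+ 2 / 100 * k%:R `^ r.
  rewrite -errE; near: k; exact: littleo_uniform.
have pos := positive_beyond_edge ha_pos ha0 hc_pos hp hr hs0 hgamma0 k1 z_gt0 z_le bal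
  zk ea eb.
have [x hx] : exists x, is_largest_zero (p k) x.
  have [x hx _] := largest_zero_interlacing k.-1 ha_pos ha0 hc_pos hp.
  by rewrite prednK// in hx; exists x.
exists x => //; rewrite addr0 -z2 leNgt; apply/negP => /ltW /pos.
by case: hx => /rootP-> _; rewrite ltxx.
Unshelve. all: by end_near. Qed.
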